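(* Let $n \ge 1$ and let $W$ be the Coxeter group of type $A_n$. For $k \ge 0$ let $\mathcal C_{n,k}$ be the set of fully commutative elements of length $k$ in $W$, and let $\mathcal D_{n+1,k}$ be the set of Dyck paths of semi-length $n+1$ such that (sum of peak heights) $-$ (number of peaks) $= k$. Then, for every $k \ge 0$, the map $\Phi$ (defined in the context) is a bijection $\Phi : \mathcal C_{n,k} \to \mathcal D_{n+1,k}$. In particular, for every $k\ge 0$, $$|\mathcal C_{n,k}| = T(n+1,k),$$ where $T(m,k) := |\mathcal D_{m,k}|$.
   Context: $W$ is the Coxeter group of type $A_n$ with generators $s_1,\dots,s_n$ ($W\cong S_{n+1}$, $s_i=(i\ i{+}1)$); length is taken with respect to these generators. Indices $i,i'$ are neighbors if $|i-i'|=1$. A reduced expression $s_{i_1}\cdots s_{i_r}$ is identified with the word $[i_1,\dots,i_r]$. An element $w\in W$ is fully commutative if any reduced word for $w$ can be obtained from any other by interchanges of adjacent commuting generators (equivalently, no reduced word for $w$ has $[i,i',i]$ with $i,i'$ neighbors as a subword of consecutive letters). A Dyck path of semi-length $m$ is a lattice path from $(0,0)$ to $(2m,0)$ with steps $\langle 1,1\rangle$ (rise) and $\langle 1,-1\rangle$ (fall) that never goes below the $x$-axis. A peak is a rise immediately followed by a fall; its location is the common endpoint of these two steps and its height is the $y$-coordinate of that point. $\mathcal D_{m,k}$ is the set of Dyck paths of semi-length $m$ with (sum of peak heights) $-$ (number of peaks) $=k$. For $1\le i\le j\le n$ put $T_i^j=[j,j-1,\dots,i+1,i]$, also regarded as the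 element $s_js_{j-1}\cdots s_i\in W$. Every fully commutative element of $W$ can be uniquely written as $T_{i_1}^{m_1}T_{i_2}^{m_2}\cdots T_{i_\ell}^{m_\ell}$ with $\ell\ge0$, $i_j\le m_j$ for each $j$, $1\le i_1<i_2<\cdots<i_\ell\le n$ and $m_1<m_2<\cdots<m_\ell \le n$. Definition of $\Phi$. To the segment $T_i^j$ ($1\le i\le j\le n$) associate the unit diamond (block) with center $(i+j,\,j-i+1)$, whose top vertex is $(i+j,\,j-i+2)$. If $w=T_{i_1}^{m_1}\cdots T_{i_\ell}^{m_\ell}$ is the unique expression above, $\Phi(w)$ is the Dyck path of semi-length $n+1$ whose peaks of height at least $2$ are located exactly at the top vertices $(i_j+m_j,\,m_j-i_j+2)$, $j=1,\dots,\ell$, of the blocks of the segments $T_{i_j}^{m_j}$; all other peaks of $\Phi(w)$, if any, have height $1$. *)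

(* Defs.v *)
From mathcomp Require Import all_boot all_fingroup.
From mathcomp Require Import boolp.

Set Implicit Arguments.
Unset Strict Implicit.
Unset Printing Implicit Defensive.

(** * The Coxeter group of type A_n *)

(* The group is 'S_n.+1 acting on {0, ..., n}, that is, {1, ..., n+1} shifted
   by one. Letters are the naturals 1, ..., n, and the letter i stands for the
   transposition of the points i - 1 and i. (inord is meaningful only for
   1 <= i <= n, which is_word enforces.)
   MathComp composes permutations from left to right; as this only replaces
   the group law by the opposite one, the s_i are Coxeter generators of type
   A_n all the same. *)
Definition gen (n i : nat) : 'S_n.+1 := tperm (inord i.-1) (inord i).

Definition is_word (n : nat) (u : seq nat) : bool :=
  all (fun i => 0 < i <= n) u.

Definition word_prod (n : nat) (u : seq nat) : 'S_n.+1 :=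
  (\prod_(i <- u) gen n i)%g.

Definition reduced_word (n : nat) (w : 'S_n.+1) (u : seq nat) : Prop :=
  [/\ is_word n u, word_prod n u = w &
      forall v, is_word n v -> word_prod n v = w -> size u <= size v].

Definition has_length (n : nat) (w : 'S_n.+1) (k : nat) : Prop :=
  exists2 u, reduced_word w u & size u = k.

Inductive comm_equiv (n : nat) (u : seq nat) : seq nat -> Prop :=
| comm_refl : comm_equiv n u u
| comm_step p q a b :
    comm_equiv n u (p ++ [:: a, b & q]) -> commute (gen n a) (gen n b) ->
    comm_equiv n u (p ++ [:: b, a & q]).

Definition fully_commutative (n : nat) (w : 'S_n.+1) : Prop :=
  forall u v, reduced_word w u -> reduced_word w v -> comm_equiv n u v.

Definition FC (n k : nat) : {set 'S_n.+1} :=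
  [set w | `[< fully_commutative w /\ has_length w k >]].

(** * Dyck paths *)

(* A path is its sequence of steps: true is a rise, false is a fall. *)
Definition rises (D : seq bool) (x : nat) : nat := count_mem true (take x D).
Definition falls (D : seq bool) (x : nat) : nat := count_mem false (take x D).

Definition dyck (D : seq bool) : bool :=
  all (fun x => falls D x <= rises D x) (iota 0 (size D).+1)
  && (rises D (size D) == falls D (size D)).

(* The y-coordinate of the point of abscissa x; the truncated subtraction is
   exact on Dyck paths. *)
Definition height (D : seq bool) (x : nat) : nat := rises D x - falls D x.

(* The points (location, height) at which a rise is followed by a fall. *)
Definition peaks (D : seq bool) : seq (nat * nat) :=
  [seq (x, height D x) |
     x <- iota 1 (size D).-1 & nth false D x.-1 && ~~ nth false D x].

(* (sum of peak heights) - (number of peaks) = k, written without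
   subtraction. *)
Definition dyck_paths (m k : nat) : {set (m.*2).-tuple bool} :=
  [set D : (m.*2).-tuple bool |
     dyck D && (\sum_(p <- peaks D) p.2 == k + size (peaks D))].

Definition T (m k : nat) : nat := #|dyck_paths m k|.

(** * The map Phi *)

(* The pair (i, j) encodes the segment T_i^j = [j, j-1, ..., i]. *)
Definition segment (a : nat * nat) : seq nat := rev (iota a.1 (a.2.+1 - a.1)).

Definition block_top (a : nat * nat) : nat * nat :=
  (a.1 + a.2, a.2 - a.1 + 2).

Definition segment_form (n : nat) (w : 'S_n.+1) (s : seq (nat * nat)) : Prop :=
  [/\ all (fun a => [&& 0 < a.1, a.1 <= a.2 & a.2 <= n]) s,
      sorted ltn [seq a.1 | a <- s],
      sorted ltn [seq a.2 | a <- s] &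
      word_prod n (flatten [seq segment a | a <- s]) = w].

Definition Phi_graph (n : nat) (w : 'S_n.+1) (D : seq bool) : Prop :=
  exists2 s, segment_form w s &
    dyck D /\ [seq p <- peaks D | 2 <= p.2] =i [seq block_top a | a <- s].

(* unset1 makes this a definite description: Phi w is the path related to w
   by Phi_graph if there is exactly one, and otherwise the path made of falls
   only, which is not a Dyck path. Hence Phi w being a Dyck path entails that
   the description is met, and met by a single path. *)
Definition Phi (n : nat) (w : 'S_n.+1) : (n.+1.*2).-tuple bool :=
  odflt [tuple of nseq n.+1.*2 false]
    (unset1 [set D : (n.+1.*2).-tuple bool | `[< Phi_graph w D >]]).

(* Main.v *)
(** Read a word in the generators as a permutation and let [inv] count
    inversions. Splitting off the smallest non-fixed point gives every [w] a
    product of segments with increasing starts whose length is [inv w], so the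
    reduced words of [w] are its words of length [inv w]. If two consecutive
    ends did not increase, the relation [T_i^m s_j = s_(j-1) T_i^m]
    ([i < j <= m]) would produce a reduced word with another multiset of
    letters, so [w] would not be fully commutative. Conversely, in a product of
    segments with increasing starts and ends, the segments are the pairs
    [(w x + 1, x)] with [w x < x], and [w] increases both on these [x] and on
    the others; hence [w] avoids the pattern 321, so that two distinct descents
    of [w] commute, and any two reduced words are linked by induction on their
    length.

    On the other side, the Dyck path with prescribed peaks of height at least 2
    is the lowest one: after [f] falls it rises exactly as long as its number of
    rises is below [f + 1] or below [m + 1] for some block [(i, m)] with
    [i <= f + 1]. *)

Require Import Defs.
From mathcomp Require Import all_boot all_fingroup.
From mathcomp Require Import zify boolp.

Set Implicit Arguments.
Unset Strict Implicit.
Unset Printing Implicit Defensive.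

(** * Generators, words and segments as permutations of the points [0, ..., n] *)

Section Group.
Local Open Scope group_scope.
Variable n : nat.
Implicit Types (w : 'S_n.+1) (x y z : 'I_n.+1) (u v : seq nat).
Implicit Types (a b : nat * nat) (s t : seq (nat * nat)).

Lemma gen_val i x : 0 < i <= n ->
  gen n i x = (if x == i.-1 :> nat then i
               else if x == i :> nat then i.-1 else x) :> nat.
Proof.
move=> Hi; rewrite /gen permE /= -!val_eqE /= !inordK; try lia.
by case: ifP => _; [rewrite inordK; lia | case: ifP => _ //; rewrite inordK; lia].
Qed.

Lemma gen_inord i :
  gen n i (inord i.-1) = inord i /\ gen n i (inord i) = inord i.-1.
Proof. by rewrite /gen tpermL tpermR. Qed.

Lemma genK i w : gen n i * (gen n i * w) = w.
Proof. by rewrite /gen mulgA tperm2 mul1g. Qed.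

Lemma gen_commute i j : 0 < i <= n -> 0 < j <= n ->
  i != j.+1 -> j != i.+1 -> commute (gen n i) (gen n j).
Proof.
move=> Hi Hj ij ji; rewrite /commute; apply/permP=> x; apply: val_inj.
rewrite /= !permM !gen_val //.
by do !case: ifP => /eqP; lia.
Qed.

Lemma word_prod_cons i u : word_prod n (i :: u) = gen n i * word_prod n u.
Proof. by rewrite /word_prod big_cons. Qed.

Lemma word_prod_cat u v : word_prod n (u ++ v) = word_prod n u * word_prod n v.
Proof. by rewrite /word_prod big_cat. Qed.

Lemma word_prod_nil : word_prod n [::] = 1.
Proof. by rewrite /word_prod big_nil. Qed.

Lemma segment_nil i : segment (i.+1, i) = [::].
Proof. by rewrite /segment /= subnn. Qed.

Lemma segmentS i m : i <= m.+1 -> segment (i, m.+1) = m.+1 :: segment (i, m).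
Proof.
by move=> im; rewrite /segment /= subSn // -[(m.+1 - i).+1]addn1 iotaD rev_cat /= subnKC.
Qed.

Lemma size_segment a : size (segment a) = a.2.+1 - a.1.
Proof. by rewrite size_rev size_iota. Qed.

Lemma is_word_segment i m : 0 < i -> m <= n -> is_word n (segment (i, m)).
Proof.
move=> i0 mn; apply/allP=> j; rewrite mem_rev mem_iota /=; lia.
Qed.

Lemma segment_val i m x : 0 < i <= m.+1 -> m <= n ->
  word_prod n (segment (i, m)) x =
    (if x == m :> nat then i.-1 else if i.-1 <= x < m then x.+1 else x) :> nat.
Proof.
case: i => // i /andP[_]; rewrite ltnS => /subnK <-.
elim: (m - i) x => [|d IH] x mn.
  rewrite add0n segment_nil word_prod_nil perm1.
  by case: eqP => // _; case: ifP => //; lia.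
rewrite addSn in mn *; rewrite segmentS ?word_prod_cons ?permM; last by lia.
rewrite IH ?gen_val; try lia.
do ![case: ifP]; lia.
Qed.

(** * Inversions and word length *)

Definition inv w :=
  #|[set p : 'I_n.+1 * 'I_n.+1 | (p.1 < p.2) && (w p.2 < w p.1)]|.

(** Left multiplication by [gen n i] permutes positions, as products act from left to right.
    Exchanging the positions [i - 1] and [i] turns the inversions of [w] into inversions of the
    product; the pair [(i - 1, i)] itself is the only new one. *)
Lemma inv_gen_asc i w : 0 < i <= n -> w (inord i.-1) < w (inord i) ->
  inv (gen n i * w) = (inv w).+1.
Proof.
move=> Hi Hw; rewrite /inv.
set A := [set p | _]; set B := [set p | _].
pose f (p : 'I_n.+1 * 'I_n.+1) := (gen n i p.1, gen n i p.2).
have fK : cancel f f by move=> [x y]; rewrite /f /= !tpermK.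
have [g1 g2] := gen_inord i.
have -> : A = (inord i.-1, inord i) |: f @: B.
  apply/setP=> -[x y]; rewrite (can_imset_pre _ fK) !inE !permM /=.
  rewrite /f /= xpair_eqE -!val_eqE /= !inordK; try lia.
  have [xi|xi] := eqVneq (x : nat) i.-1; have [yi|yi] := eqVneq (y : nat) i => /=.
  - have -> : x = inord i.-1 by apply: val_inj; rewrite /= inordK; lia.
    have -> : y = inord i by apply: val_inj; rewrite /= inordK; lia.
    rewrite g1 g2 Hw !inordK; lia.
  - have [yi'|yi'] := eqVneq (y : nat) i.-1.
      have -> : x = y by apply: val_inj; rewrite /= xi.
      by rewrite !ltnn.
    by congr andb; rewrite !gen_val //; do ![case: ifP => /eqP]; lia.
  - have [xi'|xi'] := eqVneq (x : nat) i.
      have -> : x = y by apply: val_inj; rewrite /= xi'.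
      by rewrite !ltnn.
    by congr andb; rewrite !gen_val //; do ![case: ifP => /eqP]; lia.
  - have [xi'|xi'] := eqVneq (x : nat) i; last first.
      by congr andb; rewrite !gen_val //; do ![case: ifP => /eqP]; lia.
    have [yi'|yi'] := eqVneq (y : nat) i.-1; last first.
      by congr andb; rewrite !gen_val //; do ![case: ifP => /eqP]; lia.
    have -> : x = inord i by apply: val_inj; rewrite /= inordK; lia.
    have -> : y = inord i.-1 by apply: val_inj; rewrite /= inordK; lia.
    rewrite g1 g2 !inordK; lia.
rewrite cardsU1 (card_imset _ (can_inj fK)) (can_imset_pre _ fK).
by rewrite !inE /= g1 g2 !inordK; lia.
Qed.

Lemma inv_gen_desc i w : 0 < i <= n -> w (inord i) < w (inord i.-1) ->
  inv w = (inv (gen n i * w)).+1.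
Proof.
move=> Hi Hw; have [g1 g2] := gen_inord i.
by rewrite -[in LHS](genK i w) inv_gen_asc // !permM g1 g2.
Qed.

Lemma inv1 : inv 1 = 0.
Proof.
by apply: eq_card0 => -[x y]; rewrite !inE /= !perm1; lia.
Qed.

Lemma inv_gen_leq i w : 0 < i <= n -> inv (gen n i * w) <= (inv w).+1.
Proof.
move=> Hi.
have [lt|gt|eq] := ltngtP (w (inord i.-1)) (w (inord i)).
- by rewrite inv_gen_asc.
- by rewrite [inv w](inv_gen_desc Hi) //; lia.
- have /perm_inj/(congr1 val) := val_inj eq; rewrite /= !inordK; lia.
Qed.

Lemma inv_word_leq u : is_word n u -> inv (word_prod n u) <= size u.
Proof.
elim: u => [|i u IH] /=; first by rewrite word_prod_nil inv1.
by case/andP=> Hi /IH Hu; rewrite word_prod_cons (leq_trans (inv_gen_leq _ Hi)).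
Qed.

(** If the head were not a descent, the tail would be shorter than the inversion number of its own
    product. *)
Lemma word_head_desc i u : is_word n (i :: u) ->
  size (i :: u) = inv (word_prod n (i :: u)) ->
  word_prod n (i :: u) (inord i) < word_prod n (i :: u) (inord i.-1) /\
  size u = inv (word_prod n u).
Proof.
rewrite word_prod_cons /= => /andP[Hi Hu] sz; have Hle := inv_word_leq Hu.
have [g1 g2] := gen_inord i; rewrite !permM g1 g2.
have [lt|gt|eq] := ltngtP (word_prod n u (inord i.-1)) (word_prod n u (inord i)).
- by move: sz; rewrite inv_gen_asc //; lia.
- by move: sz; rewrite (inv_gen_desc Hi gt) in Hle *; lia.
- have /perm_inj/(congr1 val) := val_inj eq; rewrite /= !inordK; lia.
Qed.

(** * Products of segments with increasing starts *)

Definition fixes_below i w := forall x, x < i -> w x = x.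

Lemma fixes_below_geq i w x : fixes_below i w -> i <= x -> i <= w x.
Proof.
move=> fw ix; rewrite leqNgt; apply/negP=> wi.
by have /perm_inj wx := fw _ wi; move: wi; rewrite wx; lia.
Qed.

(** Each letter put in front of a shorter segment creates one inversion. For the letter [k + 1], the
    position [k] then has value [i - 1], which [w] fixes, while [k + 1] is still untouched by the
    segment and gets a value at least [i]. *)
Lemma inv_segment i m w : 0 < i <= m.+1 -> m <= n -> fixes_below i w ->
  inv (word_prod n (segment (i, m)) * w) = m.+1 - i + inv w.
Proof.
case: i => // i /andP[_] + + fw; rewrite ltnS => /subnK <-.
elim: (m - i) => [|d IH] mn.
  by rewrite add0n segment_nil word_prod_nil mul1g subnn.
rewrite addSn in mn *; set k := d + i in mn IH *.
rewrite segmentS ?word_prod_cons -?mulgA; last by lia.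
rewrite inv_gen_asc ?IH; try lia.
have Hm : (inord k : 'I_n.+1) = k :> nat by rewrite inordK; lia.
have Hm1 : (inord k.+1 : 'I_n.+1) = k.+1 :> nat by rewrite inordK; lia.
have H0 : word_prod n (segment (i.+1, k)) (inord k) = i :> nat.
  by rewrite segment_val ?Hm ?eqxx //; lia.
have H1 : word_prod n (segment (i.+1, k)) (inord k.+1) = k.+1 :> nat.
  by rewrite segment_val ?Hm1; try lia; do ![case: ifP]; lia.
rewrite /= !permM fw ?H0 //; apply: fixes_below_geq => //; rewrite H1; lia.
Qed.

Definition block a := [&& 0 < a.1, a.1 <= a.2 & a.2 <= n].
Definition segments s := flatten [seq segment a | a <- s].

Lemma is_word_segments s : all block s -> is_word n (segments s).
Proof.
elim: s => //= -[i m] s IH /andP[/and3P[/= i0 im mn] Hs].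
by rewrite /is_word /segments /= all_cat -!/(is_word _ _) is_word_segment ?IH.
Qed.

Lemma size_segments s : size (segments s) = \sum_(a <- s) (a.2.+1 - a.1).
Proof.
elim: s => [|a s IH]; first by rewrite big_nil.
by rewrite big_cons /segments /= size_cat size_segment IH.
Qed.

Lemma fixes_below_segments i s :
  all block s -> all (fun a => i < a.1) s -> fixes_below i (word_prod n (segments s)).
Proof.
move=> + + x xi; elim: s => [|[j m] s IH] /=; first by rewrite word_prod_nil perm1.
case/andP=> /and3P[/= i0 im mn] Hs /andP[ij His].
rewrite /segments /= word_prod_cat permM.
have -> : word_prod n (segment (j, m)) x = x; last exact: IH.
apply: val_inj; rewrite /= segment_val; try lia.
do ![case: ifP]; lia.
Qed.

Lemma sorted_fst_eq s t : sorted ltn [seq a.1 | a <- s] ->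
  sorted ltn [seq a.1 | a <- t] -> s =i t -> s = t.
Proof.
rewrite !sorted_map; apply: irr_sorted_eq; last by move=> a /=; rewrite ltnn.
by move=> a b c /=; apply: ltn_trans.
Qed.

Lemma path_fst a s : path ltn a.1 [seq b.1 | b <- s] -> all (fun b => a.1 < b.1) s.
Proof. by move/(order_path_min ltn_trans); rewrite all_map. Qed.

Lemma path_snd a s : path ltn a.2 [seq b.2 | b <- s] -> all (fun b => a.2 < b.2) s.
Proof. by move/(order_path_min ltn_trans); rewrite all_map. Qed.

Lemma inv_segments s : all block s -> sorted ltn [seq a.1 | a <- s] ->
  inv (word_prod n (segments s)) = size (segments s).
Proof.
elim: s => [|[i m] s IH] /=; first by rewrite word_prod_nil inv1.
case/andP=> /and3P[/= i0 im mn] Hs Hp.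
rewrite /segments /= word_prod_cat size_cat inv_segment ?IH ?size_segment //; first last.
- by apply: fixes_below_segments => //; apply: (@path_fst (i, m)).
- lia.
- exact: path_sorted Hp.
Qed.

(** Induction on the number of points not yet known to be fixed. The list is kept with starts above
    the number [i] of points known to be fixed, so that a segment starting at [i + 1] can be put in
    front. *)
Lemma normal_form w : exists s,
  [/\ all block s, sorted ltn [seq a.1 | a <- s] & word_prod n (segments s) = w].
Proof.
suff H d i w' : i + d = n.+1 -> fixes_below i w' -> exists s,
    [/\ all block s, path ltn i [seq a.1 | a <- s] & word_prod n (segments s) = w'].
  have [//|//|s [Hs Hp Hw]] := H n.+1 0 w; exists s; split=> //.
  exact: path_sorted Hp.
elim: d i w' => [|d IH] i w' Hd fw.
  exists [::]; split=> //; rewrite word_prod_nil; apply/permP=> x.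
  by rewrite perm1 fw //; have := ltn_ord x; lia.
pose x0 : 'I_n.+1 := inord i; have x0i : x0 = i :> nat by rewrite inordK; lia.
have [wx0|wx0] := eqVneq (w' x0) x0.
  have [||s [Hs Hp Hw]] := IH i.+1 w'; first by lia.
    move=> x; rewrite ltnS leq_eqVlt => /orP[/eqP xi|]; last exact: fw.
    by have -> : x = x0 by apply: val_inj; rewrite /= x0i.
  exists s; split=> //; move: Hp; case: (s) => //= b s' /andP[ib ->].
  by rewrite andbT ltnW.
(* The segment from [i + 1] to [m] also sends [m] to [i], so dividing it off on the left leaves a
   permutation that fixes [i] as well. The start is [i + 1] because points count from 0 and letters
   from 1. *)
pose m := w'^-1 x0.
have wm : w' m = x0 by rewrite permKV.
have im : i < m.
  rewrite ltn_neqAle; apply/andP; split.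
    apply: contra wx0 => /eqP Him.
    have mx0 : m = x0 by apply: val_inj; rewrite /= x0i.
    by rewrite -{1}mx0 wm.
  rewrite leqNgt; apply/negP=> mi; move/(congr1 val): (fw _ mi).
  by rewrite wm /= x0i; lia.
pose t := word_prod n (segment (i.+1, m : nat)).
have mn : m <= n by rewrite -ltnS.
have tm : t m = x0 by apply: val_inj; rewrite /= segment_val ?eqxx //; lia.
have [||s [Hs Hp Hw]] := IH i.+1 (t^-1 * w'); first by lia.
  move=> x; rewrite ltnS leq_eqVlt permM => /orP[/eqP xi|xi].
    have -> : x = x0 by apply: val_inj; rewrite /= x0i.
    by rewrite -tm permK wm.
  have -> : t^-1 x = x; last exact: fw.
  apply: (@perm_inj _ t); rewrite permKV; apply: val_inj.
  rewrite /= segment_val //; last by lia.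
  by do ![case: ifP]; lia.
exists ((i.+1, m : nat) :: s); split=> /=.
- by rewrite Hs /block /= im mn.
- by rewrite ltnSn.
- by rewrite /segments /= word_prod_cat Hw mulKVg.
Qed.

(** * Reduced words and length *)

Lemma reducedP w u :
  reduced_word w u <-> [/\ is_word n u, word_prod n u = w & size u = inv w].
Proof.
split=> -[Hu Hw]; last first.
  move=> sz; split=> // v Hv Hvw; rewrite sz -Hvw; exact: inv_word_leq.
move=> min; split=> //; have [s [Hs Hp Hsw]] := normal_form w.
apply/eqP; rewrite eqn_leq -{2}Hw inv_word_leq // andbT.
by rewrite -Hsw inv_segments // min // is_word_segments.
Qed.

Lemma has_lengthP w k : has_length w k <-> inv w = k.
Proof.
split=> [[u /reducedP[_ _ ->]]//|<-].
have [s [Hs Hp Hsw]] := normal_form w; exists (segments s).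
  by apply/reducedP; rewrite -Hsw inv_segments //; split=> //; apply: is_word_segments.
by rewrite -inv_segments ?Hsw.
Qed.

(** * Full commutativity forces increasing ends *)

Lemma comm_equiv_perm u v : comm_equiv n u v -> perm_eq u v.
Proof.
elim=> // p q i j _ IH _; apply: perm_trans IH _.
by rewrite perm_cat2l; apply/seq.permP=> P /=; rewrite !addnA (addnC (P i)).
Qed.

Lemma comm_equiv_trans u v (t : seq nat) :
  comm_equiv n u v -> comm_equiv n v t -> comm_equiv n u t.
Proof. by move=> uv; elim=> // p q i j _ IH /(comm_step IH). Qed.

Lemma comm_equiv_cons i u v : comm_equiv n u v -> comm_equiv n (i :: u) (i :: v).
Proof.
elim=> [|p q j k _ IH Hjk]; first exact: comm_refl.
exact: (@comm_step _ _ (i :: p)).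
Qed.

(** The segment moves the points [i - 1, ..., m - 1] up by one, hence carries the pair exchanged by
    [gen n j.-1] to the pair exchanged by [gen n j]. *)
Lemma segment_gen i m j : 0 < i -> i < j <= m -> m <= n ->
  word_prod n (segment (i, m)) * gen n j = gen n j.-1 * word_prod n (segment (i, m)).
Proof.
move=> i0 ijm mn; apply/permP=> x; apply: val_inj.
rewrite /= !permM segment_val ?gen_val ?segment_val ?gen_val; try lia.
by do ![case: ifP]; lia.
Qed.

(** The hypothesis on [v] is the trace of full commutativity that survives the induction:
    commutations preserve the multiset of letters, and this property passes from a product to its
    tail. *)
Lemma FC_sorted_snd s : all block s -> sorted ltn [seq a.1 | a <- s] ->
  (forall v, is_word n v -> word_prod n v = word_prod n (segments s) ->
     size v = size (segments s) -> perm_eq (segments s) v) ->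
  sorted ltn [seq a.2 | a <- s].
Proof.
elim: s => //= -[i m] s IH /andP[/and3P[/= i0 im mn] Hs] Hp rigid.
have Hsorted : sorted ltn [seq a.2 | a <- s].
  apply: IH => //; first exact: path_sorted Hp.
  move=> v Hv Hvs sz; rewrite -(perm_cat2l (segment (i, m))); apply: rigid.
  - by rewrite /is_word all_cat -!/(is_word _ _) is_word_segment.
  - by rewrite /segments /= !word_prod_cat Hvs.
  - by rewrite /segments /= !size_cat sz.
case: s Hs Hp rigid Hsorted {IH} => //= -[i' m'] s /andP[/and3P[/= i'0 im' mn'] Hs].
case/andP=> ii' _ rigid ->; rewrite andbT ltnNge; apply/negP=> m'm.
have Hseg : segment (i', m') = m' :: segment (i', m'.-1).
  by case: (m') im' => [|k] ?; [lia | rewrite segmentS].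
set t := segment (i', m'.-1) ++ segments s.
have Hcons : segments [:: (i, m), (i', m') & s] = segment (i, m) ++ m' :: t.
  by rewrite /segments /= Hseg.
(* If [m' <= m], the letter [m'] crosses the first segment and becomes [m'.-1]. The two words then
   differ in their number of letters [m']. *)
suff /seq.permP/(_ (pred1 m')) :
    perm_eq (segment (i, m) ++ m' :: t) (m'.-1 :: segment (i, m) ++ t).
  have /negbTE ne : m'.-1 != m' by lia.
  by clearbody t; rewrite /= !count_cat /= eqxx ne; lia.
rewrite -Hcons; apply: rigid; rewrite ?Hcons.
- rewrite /is_word /= !all_cat -!/(is_word _ _) !is_word_segment ?is_word_segments //; lia.
- by rewrite word_prod_cons 2!word_prod_cat word_prod_cons !mulgA segment_gen //; lia.
- by rewrite /= 2!size_cat addnS.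
Qed.

Lemma FC_segment_form w : fully_commutative w -> exists s, segment_form w s.
Proof.
move=> fc; have [s [Hs Hp Hw]] := normal_form w; exists s; split=> //.
apply: FC_sorted_snd => // v Hv Hvs sz.
apply/comm_equiv_perm/fc; apply/reducedP.
  by rewrite -Hw inv_segments //; split=> //; apply: is_word_segments.
by rewrite -Hw inv_segments.
Qed.

(** * Segments read off from the permutation *)

Lemma segment_form_inv w s : segment_form w s ->
  inv w = \sum_(a <- s) (a.2.+1 - a.1).
Proof. by case=> Hs Hp _ <-; rewrite inv_segments // size_segments. Qed.

(** Induction on the first segment [(j, m)]: it sends [m] to [j - 1], which the rest fixes, and
    raises the points [j - 1, ..., m - 1] by one. The rest has ends above [m], so it never lowers a
    point up to [m]. *)
Lemma segment_form_mem s w x i : segment_form w s ->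
  ((i, x : nat) \in s) = (i == (w x).+1) && (w x < x).
Proof.
case=> Hs Hp Hq <- {w}; elim: s x i Hs Hp Hq => [|[j m] s IH] x i /=.
  by rewrite word_prod_nil perm1 ltnn andbF.
case/andP=> /and3P[/= j0 jm mn] Hs Hp Hq.
rewrite -!/(segments _) word_prod_cat permM in_cons xpair_eqE.
set t := word_prod n (segment (j, m)); set w := word_prod n (segments s).
have {}IH x' i' : ((i', x' : nat) \in s) = (i' == (w x').+1) && (w x' < x').
  by apply: IH => //; [exact: path_sorted Hp | exact: path_sorted Hq].
have fw : fixes_below j w.
  by apply: fixes_below_segments => //; apply: (@path_fst (j, m)).
have Hsnd k l : (k, l) \in s -> m < l.
  by move/(allP (@path_snd (j, m) _ Hq)).
have := @segment_val j m x; rewrite -/t => /(_ ltac:(lia) mn).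
have [xm|xm] /= := eqVneq (x : nat) m.
  move=> tx; rewrite andbT fw ?tx; last by lia.
  case: (i =P j) => [->|ij] /=; first by lia.
  by case: ((i, _) \in s) (@Hsnd i x); lia.
have [xj|xj] := leqP j.-1 x; have [xm'|xm'] := ltnP x m => /= tx; rewrite andbF /=.
- have ni : (i, x : nat) \notin s by apply/negP=> /Hsnd; lia.
  have := IH (t x) (w (t x)).+1; rewrite eqxx /= tx.
  have /negbTE-> : ((w (t x)).+1, x.+1) \notin s by apply/negP=> /Hsnd; lia.
  by move: ni => /negbTE->; lia.
- by rewrite (val_inj tx) IH.
- rewrite fw ?tx; last by lia.
  have /negbTE-> : (i, x : nat) \notin s by apply/negP=> /Hsnd; lia.
  lia.
- lia.
Qed.

Lemma segment_form_uniq w s t : segment_form w s -> segment_form w t -> s = t.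
Proof.
move=> Hs Ht.
have H s1 s2 : segment_form w s1 -> segment_form w s2 -> {subset s1 <= s2}.
  move=> H1 H2 [i m] Hin.
  have mn : m < n.+1 by case: (H1) => /allP/(_ _ Hin)/and3P[].
  by rewrite (segment_form_mem (Ordinal mn) i H2) -(segment_form_mem (Ordinal mn) i H1).
have [[_ ps _ _] [_ pt _ _]] := (Hs, Ht).
by apply: sorted_fst_eq => // a; apply/idP/idP; apply: H.
Qed.

(** The first segment [(j, m)] keeps the order of all points other than [m], and takes [m] down to
    [j - 1], fixed by the rest. So the order changes only between [m] and points that are not
    lowered. *)
Lemma segment_form_mono w s x y : segment_form w s ->
  x < y -> (w x < x) = (w y < y) -> w x < w y.
Proof.
case=> Hs Hp Hq <- {w}; elim: s x y Hs Hp Hq => [|[j m] s IH] x y /=.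
  by rewrite word_prod_nil !perm1.
case/andP=> /and3P[/= j0 jm mn] Hs Hp Hq.
rewrite -!/(segments _) word_prod_cat !permM.
set t := word_prod n (segment (j, m)); set w := word_prod n (segments s).
have Hp' := path_sorted Hp; have Hq' := path_sorted Hq.
have {}IH x' y' : x' < y' -> (w x' < x') = (w y' < y') -> w x' < w y' by exact: IH.
have fw : fixes_below j w.
  by apply: fixes_below_segments => //; apply: (@path_fst (j, m)).
have low z : z <= m -> z <= w z.
  move=> zm; have := @segment_form_mem s w z (w z).+1.
  rewrite eqxx /= => H; rewrite leqNgt -H //; apply/negP.
  by move/(allP (@path_snd (j, m) _ Hq)) => /=; lia.
have tv z : t z = (if z == m :> nat then j.-1 else if j.-1 <= z < m then z.+1 else z) :> nat.
  by apply: segment_val => //; lia.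
have hi z : m < z -> t z = z.
  by move=> mz; apply: val_inj; rewrite /= tv; do ![case: ifP]; lia.
move=> xy.
have [xj|xj] := ltnP x j.-1.
  have tx : t x = x by apply: val_inj; rewrite /= tv; do ![case: ifP]; lia.
  rewrite tx fw; last by lia.
  move=> _; apply: (@fixes_below_geq x.+1); first by move=> z zx; apply: fw; lia.
  by rewrite tv; do ![case: ifP]; lia.
have [mx|xm|xm] := ltngtP m x.
- by rewrite !hi //; [exact: IH | lia].
- have tx : t x = x.+1 :> nat by rewrite tv; do ![case: ifP]; lia.
  have lx := low (t x); rewrite tx in lx.
  have [my|ym|ym] := ltngtP m y.
  + by rewrite (hi y) // => E; apply: IH; lia.
  + have ty : t y = y.+1 :> nat by rewrite tv; do ![case: ifP]; lia.
    have ly := low (t y); rewrite ty in ly.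
    by move=> _; apply: IH; lia.
  + have ty : t y = j.-1 :> nat by rewrite tv; do ![case: ifP]; lia.
    have -> : w (t y) = t y by apply: fw; lia.
    by rewrite ty; lia.
- have tx : t x = j.-1 :> nat by rewrite tv; do ![case: ifP]; lia.
  have -> : w (t x) = t x by apply: fw; lia.
  move=> _; rewrite (hi y) ?tx; try lia.
  by have := @fixes_below_geq j w y fw; lia.
Qed.

(** * Pattern avoidance implies full commutativity *)

Definition avoids321 w := forall x y z, x < y < z -> ~~ (w z < w y < w x).

(** Of three points, two agree on whether [w] lowers them, and [w] keeps the order of these two. *)
Lemma segment_form_avoids321 w s : segment_form w s -> avoids321 w.
Proof.
move=> Hs x y z /andP[xy yz].
have mono := segment_form_mono Hs.
have := mono _ _ xy; have := mono _ _ yz; have := mono _ _ (ltn_trans xy yz).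
by case: (w x < x); case: (w y < y); case: (w z < z) => Hxz Hyz Hxy; lia.
Qed.

(** As [i] is a descent of [w], the pair [(i - 1, i)] is no inversion of the product. So [gen n i]
    keeps the order of every inverted pair, and a 321 of the product gives one of [w]. *)
Lemma avoids321_gen w i : 0 < i <= n -> w (inord i) < w (inord i.-1) ->
  avoids321 w -> avoids321 (gen n i * w).
Proof.
move=> Hi Hd av; have [g1 g2] := gen_inord i.
have key x y : x < y -> (gen n i * w)%g y < (gen n i * w)%g x -> gen n i x < gen n i y.
  rewrite !permM !gen_val // => xy.
  have [xi|xi] := eqVneq (x : nat) i.-1; last by do ![case: ifP]; lia.
  have [yi|yi] := eqVneq (y : nat) i; last by do ![case: ifP]; lia.
  have -> : x = inord i.-1 by apply: val_inj; rewrite /= inordK; lia.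
  have -> : y = inord i by apply: val_inj; rewrite /= inordK; lia.
  by rewrite g1 g2; lia.
move=> x y z /andP[xy yz]; apply/negP=> /andP[H1 H2].
have := av (gen n i x) (gen n i y) (gen n i z).
by rewrite !key //= -!permM H1 H2 => /(_ isT).
Qed.

Lemma avoids321_desc w i j : 0 < i <= n -> 0 < j <= n -> avoids321 w ->
  w (inord i) < w (inord i.-1) -> w (inord j) < w (inord j.-1) -> j != i.+1.
Proof.
move=> Hi Hj av di dj; apply/eqP=> ji; rewrite ji /= in dj.
have := av (inord i.-1) (inord i) (inord i.+1).
rewrite di dj !inordK; lia.
Qed.

(** Induction on length. Distinct heads [i] and [j] are both descents of [w], hence commute, and [w]
    has reduced words [[:: i, j & t]] and [[:: j, i & t]]. The induction hypothesis links [u] to the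
    first and [v] to the second, after removal of the common head. *)
Lemma avoids321_comm_equiv w u v : avoids321 w ->
  is_word n u -> word_prod n u = w -> size u = inv w ->
  is_word n v -> word_prod n v = w -> size v = inv w -> comm_equiv n u v.
Proof.
elim: {u}(size u) {-2}u (erefl (size u)) v w => [|k IH] u szu v w av Hu uw eu Hv vw ev.
  have -> : u = [::] by apply/nilP; rewrite /nilp szu.
  have -> : v = [::] by apply/nilP; rewrite /nilp ev -eu szu.
  exact: comm_refl.
case: u => // i u in szu Hu uw eu *; case: v => [|j v] in Hv vw ev *.
  by move: eu; rewrite -ev.
have [Hi Hu'] := andP Hu; have [Hj Hv'] := andP Hv.
have [di su] : w (inord i) < w (inord i.-1) /\ size u = inv (word_prod n u).
  by rewrite -uw; apply: word_head_desc; rewrite ?uw.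
have [dj sv] : w (inord j) < w (inord j.-1) /\ size v = inv (word_prod n v).
  by rewrite -vw; apply: word_head_desc; rewrite ?vw.
have pu : word_prod n u = gen n i * w by rewrite -uw word_prod_cons genK.
have pv : word_prod n v = gen n j * w by rewrite -vw word_prod_cons genK.
have [ij|ij] := eqVneq i j.
  rewrite -ij in pv *; apply: comm_equiv_cons.
  apply: (IH u _ v (gen n i * w)) => //.
  - by case: szu.
  - exact: avoids321_gen.
  - by rewrite su pu.
  - by rewrite sv pv.
have ji : j != i.+1 by apply: (@avoids321_desc w).
have ij' : i != j.+1 by apply: (@avoids321_desc w).
have cij := gen_commute Hi Hj ij' ji.
(* Removing [i] leaves [j] a descent, since [gen n i] fixes the points [j - 1] and [j]. *)
have dji : (gen n i * w)%g (inord j) < (gen n i * w)%g (inord j.-1).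
  rewrite !permM.
  have -> : gen n i (inord j) = inord j.
    by apply: val_inj; rewrite /= gen_val // inordK; last lia; do ![case: ifP]; lia.
  have -> // : gen n i (inord j.-1) = inord j.-1.
  by apply: val_inj; rewrite /= gen_val // inordK; last lia; do ![case: ifP]; lia.
have [s [Hs Hp Hsw]] := normal_form (gen n j * (gen n i * w)).
pose t := segments s.
have Ht : is_word n t by apply: is_word_segments.
have st : size t = inv (gen n j * (gen n i * w)) by rewrite -Hsw inv_segments.
have e1 : inv (gen n i * w) = (size t).+1 by rewrite st -inv_gen_desc.
have e2 : inv (gen n j * w) = (size t).+1.
  have [suv] : size (i :: u) = size (j :: v) by rewrite eu ev.
  by rewrite -e1 -pu -pv -su -sv.
have p1 : word_prod n (j :: t) = gen n i * w by rewrite word_prod_cons Hsw genK.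
have p2 : word_prod n (i :: t) = gen n j * w.
  by rewrite word_prod_cons Hsw !mulgA cij -2!mulgA genK.
have c1 : comm_equiv n (i :: u) [:: i, j & t].
  apply: comm_equiv_cons; apply: (IH u _ _ (gen n i * w)) => //=.
  - by case: szu.
  - exact: avoids321_gen.
  - by rewrite su pu.
  - by rewrite /is_word /= Hj.
have c2 : comm_equiv n [:: j, i & t] (j :: v).
  apply: comm_equiv_cons; apply: (IH _ _ v (gen n j * w)) => //=.
  - by rewrite -e1 -pu -su; case: szu.
  - exact: avoids321_gen.
  - by rewrite /is_word /= Hi.
  - by rewrite sv pv.
apply: comm_equiv_trans c2.
exact: (@comm_step _ _ [::] t i j c1).
Qed.

Lemma segment_form_FC w s : segment_form w s -> fully_commutative w.
Proof.
move=> Hs u v /reducedP[Hu uw eu] /reducedP[Hv vw ev].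
exact: (avoids321_comm_equiv (segment_form_avoids321 Hs)).
Qed.

Lemma FC_memP w k : w \in FC n k <->
  exists2 s, segment_form w s & \sum_(a <- s) (a.2.+1 - a.1) = k.
Proof.
rewrite inE; split=> [/asboolP[/FC_segment_form[s Hs] /has_lengthP Hk]|[s Hs Hk]].
  by exists s; rewrite // -(segment_form_inv Hs).
apply/asboolP; split; first exact: segment_form_FC Hs.
by apply/has_lengthP; rewrite (segment_form_inv Hs).
Qed.

End Group.

(** * Steps and peaks of Dyck paths *)

Section Dyck.
Implicit Types (D : seq bool) (s : seq (nat * nat)) (a : nat * nat).

Lemma rises_falls D x : x <= size D -> rises D x + falls D x = x.
Proof.
move=> xD; rewrite /rises /falls -[RHS](size_takel xD) -(count_predC (pred1 true)).
by congr (_ + _); apply: eq_count => -[].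
Qed.

Lemma risesS D x : x < size D -> rises D x.+1 = rises D x + nth false D x.
Proof.
by move=> xD; rewrite /rises (take_nth false xD) -cats1 count_cat /= addn0; case: nth.
Qed.

Lemma fallsS D x : x < size D -> falls D x.+1 = falls D x + ~~ nth false D x.
Proof.
by move=> xD; rewrite /falls (take_nth false xD) -cats1 count_cat /= addn0; case: nth.
Qed.

Lemma count_take_leq (P : pred bool) D x y :
  x <= y -> count P (take x D) <= count P (take y D).
Proof.
move=> xy; rewrite -[in leqRHS](cat_take_drop x (take y D)) count_cat take_takel //.
exact: leq_addr.
Qed.

Lemma dyckP D :
  reflect ((forall x, x <= size D -> falls D x <= rises D x) /\
           rises D (size D) = falls D (size D)) (dyck D).
Proof.
apply: (iffP andP) => -[H /eqP E]; split=> //.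
  by move=> x xD; apply: (allP H); rewrite mem_iota.
by apply/allP=> x; rewrite mem_iota add0n ltnS; apply: H.
Qed.

Definition peak D x := [&& 0 < x, x < size D, nth false D x.-1 & ~~ nth false D x].

Lemma mem_peaks D p : (p \in peaks D) = peak D p.1 && (p.2 == height D p.1).
Proof.
case: p => x h /=; apply/mapP/andP=> [[y]|[/and4P[x0 xD Dx Dx'] /eqP->]].
  rewrite mem_filter mem_iota => /andP[/andP[H1 H2] Hy] [-> ->].
  by rewrite eqxx /peak H1 H2 !andbT; split=> //; lia.
by exists x => //; rewrite mem_filter mem_iota Dx Dx' /=; lia.
Qed.

Lemma peaks_uniq D : uniq (peaks D).
Proof.
rewrite map_inj_in_uniq; first exact/filter_uniq/iota_uniq.
by move=> x y _ _ [].
Qed.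

Lemma peak_pred D x : peak D x -> exists y,
  [/\ x = y.+1, nth false D y, rises D x = (rises D y).+1 & falls D x = falls D y].
Proof.
case: x => [|x] /and4P[//= _ xD Dx Dx'].
by exists x; rewrite risesS 1?fallsS ?Dx ?addn0 ?addn1 //; apply: ltnW.
Qed.

Lemma peak_height_gt0 D x : dyck D -> peak D x -> falls D x < rises D x.
Proof.
move=> /dyckP[HD _] /and4P[_ xD _ Dx]; have := HD _ xD.
by rewrite risesS // fallsS // (negbTE Dx) /=; lia.
Qed.

Lemma next_peak D x : dyck D -> x < size D -> nth false D x -> exists y,
  [/\ peak D y, x < y, falls D y = falls D x & rises D x < rises D y].
Proof.
move=> dD; have [HD E] := dyckP _ dD.
elim: {x}(size D - x) {-2}x (erefl (size D - x)) => [|d IH] x Hd xD Dx; first by lia.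
have r1 := risesS xD; have f1 := fallsS xD; rewrite Dx /= in r1 f1.
have [x1D|x1D] := ltnP x.+1 (size D); last first.
  have e : x.+1 = size D by lia.
  by rewrite e in r1 f1; have := HD _ (ltnW xD); lia.
case Dx1 : (nth false D x.+1).
  have [|//|//|y [py xy fy ry]] := IH x.+1; first by lia.
  by exists y; split=> //; lia.
by exists x.+1; split; [rewrite /peak /= x1D Dx Dx1 | lia..].
Qed.

Definition tall_peaks D := [seq p <- peaks D | 2 <= p.2].

Lemma tall_peaks_block D a : a.1 <= a.2 -> block_top a \in tall_peaks D ->
  [/\ peak D (a.1 + a.2), (falls D (a.1 + a.2)).+1 = a.1 &
      rises D (a.1 + a.2) = a.2.+1].
Proof.
case: a => i m /= im; rewrite mem_filter mem_peaks /= => /and3P[_ pk /eqP].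
have /and4P[_ xD _ _] := pk; have := rises_falls (ltnW xD).
by rewrite /height => ? ?; split=> //; lia.
Qed.

Lemma block_tall_peaks D x : peak D x -> falls D x + 2 <= rises D x ->
  block_top ((falls D x).+1, (rises D x).-1) \in tall_peaks D.
Proof.
move=> pk h2; have /and4P[_ xD _ _] := pk; have rf := rises_falls (ltnW xD).
rewrite /block_top /= mem_filter mem_peaks /=.
have -> : (falls D x).+1 + (rises D x).-1 = x by lia.
by rewrite pk /= /height; lia.
Qed.

Lemma block_top_inj a b : a.1 <= a.2 -> b.1 <= b.2 -> block_top a = block_top b -> a = b.
Proof. by case: a b => [i m] [j l] /= ? ? [? ?]; congr pair; lia. Qed.

(* The number of rises before the [f]-th fall, falls being counted from 1, of
   the path with blocks [s]. *)
Definition ceiling s f := maxn f (\max_(a <- s | a.1 <= f) a.2.+1).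

Lemma ceiling_leq s f r :
  reflect (f <= r /\ forall a, a \in s -> a.1 <= f -> a.2 < r) (ceiling s f <= r).
Proof.
rewrite geq_max; apply: (iffP andP) => -[fr].
  by move/bigmax_leqP_seq=> H; split.
by move=> H; split=> //; apply/bigmax_leqP_seq.
Qed.

Lemma ceiling_geq s f : f <= ceiling s f.
Proof. exact: leq_maxl. Qed.

Lemma ceiling_mem s a f : a \in s -> a.1 <= f -> a.2 < ceiling s f.
Proof. by case: (ceiling_leq s f _ (leqnn _)) => _; apply. Qed.

Lemma ceiling_mono s f g : f <= g -> ceiling s f <= ceiling s g.
Proof.
move=> fg; apply/ceiling_leq; split; first exact: leq_trans fg (ceiling_geq _ _).
by move=> a sa af; apply: ceiling_mem => //; apply: leq_trans fg.
Qed.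

Lemma sorted_pair_ltn s a b : sorted ltn [seq c.1 | c <- s] ->
  sorted ltn [seq c.2 | c <- s] -> a \in s -> b \in s -> a.1 < b.1 -> a.2 < b.2.
Proof.
elim: s => //= c s IH Hp Hq; rewrite !in_cons.
have H1 := allP (path_fst Hp); have H2 := allP (path_snd Hq).
case/orP=> [/eqP->|sa] /orP[/eqP->|sb] ab.
- by rewrite ltnn in ab.
- exact: H2.
- by have := H1 _ sa; lia.
- by apply: IH => //; [exact: path_sorted Hp | exact: path_sorted Hq].
Qed.

Lemma sorted_pair_inj s a b : sorted ltn [seq c.1 | c <- s] ->
  a \in s -> b \in s -> a.1 = b.1 -> a = b.
Proof.
elim: s => //= c s IH Hp; rewrite !in_cons.
have H1 := allP (path_fst Hp).
case/orP=> [/eqP->|sa] /orP[/eqP->|sb] // ab.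
- by have := H1 _ sb; rewrite /= ab ltnn.
- by have := H1 _ sa; rewrite /= ab ltnn.
- by apply: IH => //; exact: path_sorted Hp.
Qed.

Definition greedy s D := forall x, x < size D ->
  nth false D x = (rises D x < ceiling s (falls D x).+1).

Lemma greedy_exists s N : exists D, size D = N /\ greedy s D.
Proof.
elim: N => [|N [D [sD gD]]]; first by exists [::].
exists (rcons D (rises D N < ceiling s (falls D N).+1)); split; first by rewrite size_rcons sD.
move=> x; rewrite size_rcons sD ltnS nth_rcons sD => xN.
rewrite /rises /falls -cats1 takel_cat ?sD // -/(rises D x) -/(falls D x).
by move: xN; rewrite leq_eqVlt => /orP[/eqP->|xN]; rewrite ?ltnn ?eqxx // xN gD ?sD.
Qed.

Lemma greedy_uniq s D D' : size D = size D' -> greedy s D -> greedy s D' -> D = D'.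
Proof.
move=> sz gD gD'.
suff H x : x <= size D -> take x D = take x D'.
  by rewrite -[D]take_size -[RHS]take_size -sz H.
elim: x => [|x IH] xD; first by rewrite !take0.
have IH' := IH (ltnW xD).
rewrite (take_nth false xD) (take_nth false) -?sz // IH' gD // gD' -?sz //.
by rewrite /rises /falls IH'.
Qed.

Section Blocks.
Variables (n : nat) (s : seq (nat * nat)).
Hypothesis Hs : all (block n) s.

Lemma blockP a : a \in s -> [/\ 0 < a.1, a.1 <= a.2 & a.2 <= n].
Proof. by move/(allP Hs)/and3P. Qed.

Lemma ceiling0 : ceiling s 0 = 0.
Proof.
apply/eqP; rewrite -leqn0; apply/ceiling_leq; split=> // a /blockP[]; lia.
Qed.

Lemma ceiling_leqn f : f <= n.+1 -> ceiling s f <= n.+1.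
Proof. by move=> fn; apply/ceiling_leq; split=> // a /blockP[]. Qed.

Lemma ceiling_jump f : ceiling s f < ceiling s f.+1 -> f.+1 < ceiling s f.+1 ->
  (f.+1, (ceiling s f.+1).-1) \in s.
Proof.
move=> lt1 lt2; apply/negPn/negP=> ns.
have : ceiling s f.+1 <= (ceiling s f.+1).-1; last by lia.
apply/ceiling_leq; split; first by lia.
move=> [i m] sa /= ai.
have := ceiling_mem sa ai; move: ai; rewrite /= leq_eqVlt => /orP[/eqP ei|ai].
  have : m != (ceiling s f.+1).-1 by apply: contraNneq ns => <-; rewrite -ei.
  by lia.
by have := @ceiling_mem s _ f sa ai; rewrite /=; lia.
Qed.

Lemma greedy_between D x : greedy s D -> x <= size D ->
  ceiling s (falls D x) <= rises D x <= ceiling s (falls D x).+1.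
Proof.
move=> gD; elim: x => [|x IH] xD; first by rewrite /rises /falls take0 ceiling0.
have := IH (ltnW xD); have := gD x xD; rewrite risesS // fallsS //.
case: (nth _ _ _); rewrite /= ?addn0 ?addn1; first by lia.
by have := @ceiling_mono s (falls D x).+1 (falls D x).+2 (leqnSn _); lia.
Qed.

Lemma greedy_at D f r : greedy s D -> f + r <= size D ->
  ceiling s f <= r <= ceiling s f.+1 -> falls D (f + r) = f /\ rises D (f + r) = r.
Proof.
move=> gD fr Hfr; have := greedy_between gD fr; have := rises_falls fr.
set f' := falls _ _; set r' := rises _ _ => E.
have [lt|lt|] := ltngtP f' f; last by lia.
- by have := ceiling_mono s lt; lia.
- by have := ceiling_mono s lt; lia.
Qed.

Lemma greedy_dyck D : size D = n.+1.*2 -> greedy s D -> dyck D.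
Proof.
move=> sD gD.
have H x : x <= size D -> falls D x <= rises D x.
  move=> /(greedy_between gD)/andP[+ _].
  exact/leq_trans/ceiling_geq.
apply/dyckP; split=> //.
have := rises_falls (leqnn (size D)); have := H _ (leqnn _).
have := greedy_between gD (leqnn _); rewrite sD.
set f := falls _ _; set r := rises _ _ => Hr.
have [fn|] := leqP f n; last by lia.
by have := @ceiling_leqn f.+1 fn; lia.
Qed.

Lemma dyck_greedy D : dyck D -> tall_peaks D =i [seq block_top a | a <- s] -> greedy s D.
Proof.
move=> dD HD x xD; have [dD1 _] := dyckP _ dD.
case Dx: (nth false D x); symmetry.
  have [y [py xy fy ry]] := next_peak dD xD Dx.
  apply: leq_trans ry _; rewrite -fy.
  have [h2|h2] := leqP (falls D y + 2) (rises D y); last first.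
    by apply: leq_trans (ceiling_geq _ _); lia.
  have := block_tall_peaks py h2; rewrite HD => /mapP[b sb].
  have [_ b12 _] := blockP sb.
  move/block_top_inj => H; move: sb; rewrite -H //=; last by lia.
  by move/ceiling_mem/(_ (leqnn _)) => /=; lia.
apply/negbTE; rewrite -leqNgt; apply/ceiling_leq; split.
  by have := dD1 _ xD; rewrite risesS // fallsS // Dx /=; lia.
move=> a sa af; have [_ a12 _] := blockP sa.
have := map_f block_top sa; rewrite -HD => /(tall_peaks_block a12)[py fy ry].
have [yx|xy] := leqP (a.1 + a.2) x.
  by have := count_take_leq (pred1 true) D yx; rewrite -!/(rises _ _) ry.
have := count_take_leq (pred1 false) D xy; rewrite -!/(falls _ _) fallsS // Dx /=.
by lia.
Qed.

Hypothesis Hp : sorted ltn [seq a.1 | a <- s].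

Lemma tall_peaks_statistic D : dyck D -> tall_peaks D =i [seq block_top a | a <- s] ->
  \sum_(p <- peaks D) p.2 = \sum_(a <- s) (a.2.+1 - a.1) + size (peaks D).
Proof.
move=> dD HD.
have -> : \sum_(p <- peaks D) p.2 = \sum_(p <- peaks D) (p.2.-1 + 1).
  rewrite !big_seq; apply: eq_bigr => p; rewrite mem_peaks => /andP[pk /eqP->].
  by have := peak_height_gt0 dD pk; rewrite /height; lia.
rewrite big_split sum1_size /=; congr (_ + _).
have -> : \sum_(p <- peaks D) p.2.-1 = \sum_(p <- tall_peaks D) p.2.-1.
  rewrite /tall_peaks big_filter [RHS]big_mkcond; apply: eq_bigr => -[x [|[|h]]] //=.
have bs : {in s, forall a, a.1 <= a.2} by move=> a /blockP[].
have us : uniq [seq block_top a | a <- s].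
  rewrite map_inj_in_uniq; last by move=> a b sa sb; apply: block_top_inj; apply: bs.
  by apply: (@map_uniq _ _ fst); apply: sorted_uniq Hp; [exact: ltn_trans | exact: ltnn].
rewrite (perm_big [seq block_top a | a <- s]) /=; last first.
  by apply: uniq_perm => //; apply/filter_uniq/peaks_uniq.
rewrite big_map !big_seq; apply: eq_bigr => a /bs; rewrite /=; lia.
Qed.

Hypothesis Hq : sorted ltn [seq a.2 | a <- s].

Lemma ceiling_block i m : (i, m) \in s -> ceiling s i = m.+1 /\ ceiling s i.-1 <= m.
Proof.
move=> im; have [/= i0 le_im mn] := blockP im.
have H a : a \in s -> a.1 < i -> a.2 < m.
  by move=> sa ai; apply: (sorted_pair_ltn Hp Hq sa im).
split; last by apply/ceiling_leq; split; [lia | move=> a sa ai; apply: H => //; lia].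
apply/eqP; rewrite eqn_leq (ceiling_mem im) // andbT; apply/ceiling_leq; split; first by lia.
move=> a sa; rewrite leq_eqVlt => /orP[/eqP ai|/H-/(_ sa)]; last by lia.
by rewrite (sorted_pair_inj Hp sa im ai).
Qed.

Lemma greedy_tall_peaks D : size D = n.+1.*2 -> greedy s D ->
  tall_peaks D =i [seq block_top a | a <- s].
Proof.
move=> sD gD [x h]; apply/idP/mapP=> [|[[i m] sa ->]].
  rewrite mem_filter mem_peaks /= => /and3P[h2 pk /eqP hE].
  have [y [xy Dy ry fy]] := peak_pred pk; have /and4P[_ xD _ Dx] := pk.
  have := rises_falls (ltnW xD).
  move: Dx; rewrite (gD _ xD) -leqNgt.
  have := greedy_between gD (ltnW xD); rewrite {1}fy.
  have yD : y < size D by lia.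
  have := greedy_between gD (ltnW yD); move: Dy; rewrite (gD _ yD).
  move: h2; rewrite hE /height -fy ry => ? ? ? ? ? ?.
  have rE : (rises D y).+1 = ceiling s (falls D x).+1 by lia.
  exists ((falls D x).+1, (ceiling s (falls D x).+1).-1); first by apply: ceiling_jump; lia.
  by rewrite -rE /block_top /=; congr pair; lia.
have [/= i0 im mn] := blockP sa; have [c1 c2] := ceiling_block sa.
have Ei : i.-1.+1 = i by lia.
have [f1 r1] : falls D (i.-1 + m.+1) = i.-1 /\ rises D (i.-1 + m.+1) = m.+1.
  by apply: greedy_at; rewrite ?Ei //; lia.
have [f2 r2] : falls D (i.-1 + m) = i.-1 /\ rises D (i.-1 + m) = m.
  by apply: greedy_at; rewrite ?Ei //; lia.
have e1 : i.-1 + m.+1 = i + m by lia.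
have e2 : (i + m).-1 = i.-1 + m by lia.
rewrite mem_filter mem_peaks /= /peak /height e2 -e1 f1 r1.
rewrite !gD; try lia.
by rewrite f1 r1 f2 r2 Ei c1; lia.
Qed.

End Blocks.

Lemma blocks_of_dyck n D : size D = n.+1.*2 -> dyck D -> exists s,
  [/\ all (block n) s, sorted ltn [seq a.1 | a <- s], sorted ltn [seq a.2 | a <- s] &
      tall_peaks D =i [seq block_top a | a <- s]].
Proof.
move=> sD dD; have [dD1 dD2] := dyckP _ dD.
pose P x := peak D x && (falls D x + 2 <= rises D x).
pose t := [seq x <- iota 0 (size D) | P x].
have Pt : {in t, forall x, P x} by move=> x; rewrite mem_filter => /andP[].
have st : sorted ltn t by apply: sorted_filter (iota_ltn_sorted _ _); exact: ltn_trans.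
have mono : {in t &, forall x y, x < y -> falls D x < falls D y /\ rises D x < rises D y}.
  move=> x y /Pt/andP[/and4P[_ xD _ Dx] _] /Pt/andP[py _] xy.
  have [z [yz Dz ry fy]] := peak_pred py.
  split.
    have := count_take_leq (pred1 false) D xy; rewrite -!/(falls _ _) fallsS // (negbTE Dx) /=.
    by lia.
  by rewrite yz ltnS in xy; have := count_take_leq (pred1 true) D xy; rewrite -!/(rises _ _) ry.
have rn x : x < size D -> rises D x <= n.+1.
  move=> /ltnW xD; have := count_take_leq (pred1 true) D xD; rewrite -!/(rises _ _).
  by have := rises_falls (leqnn (size D)); lia.
exists [seq ((falls D x).+1, (rises D x).-1) | x <- t]; split.
- apply/allP=> _ /mapP[x /Pt/andP[/and4P[_ xD _ _] h2] ->].
  by have := rn _ xD; rewrite /block /=; lia.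
- rewrite -map_comp; apply: (homo_sorted_in _ (allss t) st) => x y xt yt xy /=.
  by have [? ?] := mono _ _ xt yt xy; lia.
- rewrite -map_comp; apply: (homo_sorted_in _ (allss t) st) => x y xt yt xy /=.
  by have [? ?] := mono _ _ xt yt xy; have /andP[_] := Pt _ xt; lia.
move=> [x h]; apply/idP/mapP=> [|[_ /mapP[y yt ->] ->]]; last first.
  by have /andP[py h2] := Pt _ yt; apply: block_tall_peaks.
rewrite mem_filter mem_peaks /= => /and3P[h2 pk /eqP hE].
have /and4P[_ xD _ _] := pk; have := rises_falls (ltnW xD).
rewrite hE /height in h2 * => rf.
exists ((falls D x).+1, (rises D x).-1); last by rewrite /block_top /=; congr pair; lia.
apply/mapP; exists x => //; rewrite mem_filter mem_iota /P pk xD; lia.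
Qed.

End Dyck.

Lemma Phi_segment_form n (w : 'S_n.+1) s : segment_form w s ->
  dyck (Phi w) /\ tall_peaks (Phi w) =i [seq block_top a | a <- s].
Proof.
move=> Hw; have [Hs Hp Hq _] := Hw.
have [D [sD gD]] := greedy_exists s n.+1.*2.
have dD := greedy_dyck Hs sD gD.
have tD := greedy_tall_peaks Hs Hp Hq sD gD.
pose D' : (n.+1.*2).-tuple bool := tcast sD (in_tuple D).
have D'E : D' = D :> seq bool by rewrite val_tcast.
suff -> : Phi w = D' by rewrite D'E.
rewrite /Phi (_ : finset _ = [set D']) ?set1K //.
apply/setP=> E; rewrite !inE; apply/asboolP/eqP=> [[t Ht [dE tE]]|->]; last first.
  by exists s => //; rewrite D'E.
apply: val_inj; rewrite /= D'E.
apply: (@greedy_uniq s); rewrite ?size_tuple ?sD //.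
by apply: (dyck_greedy Hs) => //; rewrite (segment_form_uniq Hw Ht).
Qed.

Theorem theorem2p1 (n : nat) (hn : 1 <= n) (k : nat) :
  [/\ {in FC n k, forall w, Phi w \in dyck_paths n.+1 k},
      {in FC n k &, injective (@Phi n)},
      {in dyck_paths n.+1 k, forall D, exists2 w, w \in FC n k & Phi w = D} &
      #|FC n k| = T n.+1 k].
Proof.
have P1 : {in FC n k, forall w, Phi w \in dyck_paths n.+1 k}.
  move=> w /FC_memP[s Hw Hk]; have [dD tD] := Phi_segment_form Hw.
  have [Hs Hp Hq _] := Hw.
  by rewrite inE dD (tall_peaks_statistic Hs Hp dD tD) Hk eqxx.
have P2 : {in FC n k &, injective (@Phi n)}.
  move=> w w' /FC_memP[s Hw _] /FC_memP[s' Hw' _] E.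
  have [_ tD] := Phi_segment_form Hw; have [dD' tD'] := Phi_segment_form Hw'.
  have [Hs Hp Hq ws] := Hw; have [Hs' Hp' Hq' ws'] := Hw'.
  suff ss' : s = s' by rewrite -ws -ws' ss'.
  have sub t t' : all (block n) t -> all (block n) t' ->
      [seq block_top a | a <- t] =i [seq block_top a | a <- t'] -> {subset t <= t'}.
    move=> Ht Ht' tt' a ta; have := map_f block_top ta; rewrite tt' => /mapP[b tb].
    have /and3P[_ a12 _] := allP Ht _ ta; have /and3P[_ b12 _] := allP Ht' _ tb.
    by move/block_top_inj=> ->.
  by apply: sorted_fst_eq => // a; apply/idP/idP; apply: sub => // b; rewrite -tD -tD' E.
have P3 : {in dyck_paths n.+1 k, forall D, exists2 w, w \in FC n k & Phi w = D}.
  move=> D; rewrite inE => /andP[dD /eqP kD].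
  have [s [Hs Hp Hq tD]] := blocks_of_dyck (size_tuple D) dD.
  have Hw : segment_form (word_prod n (segments s)) s by [].
  exists (word_prod n (segments s)).
    apply/FC_memP; exists s => //; apply: (@addIn (size (peaks D))).
    by rewrite -(tall_peaks_statistic Hs Hp dD tD).
  have [dP tP] := Phi_segment_form Hw.
  apply: val_inj; apply: (@greedy_uniq s); first by rewrite !size_tuple.
    exact: (dyck_greedy Hs dP tP).
  exact: (dyck_greedy Hs dD tD).
split=> //; rewrite /T -(card_in_imset P2); apply: eq_card => D.
by apply/imsetP/idP=> [[w /P1 + ->]//|/P3[w Hw <-]]; exists w.
Qed.
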